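(* Let $0<\alpha\le 1$, $1<p<\infty$, and let $$\Omega=\{(x,y)\in\mathbb{R}^2:\ 0<x<1,\ |y|<x^{1/\alpha}\}.$$ If for some $\beta\le 0$ the operator $\operatorname{div}:W^{1,p}_0(\Omega)^2\to L^p_0(\Omega,\beta)$ admits a continuous right inverse, then $\beta\le\alpha-1$.
   Context: $d(x)$ denotes the distance from $x$ to $\partial\Omega$. For $\gamma\in\mathbb{R}$, $L^p(\Omega,\gamma)$ is the space with norm $\|u\|_{L^p(\Omega,\gamma)}:=\|u\,d^\gamma\|_{L^p(\Omega)}$. When $L^p(\Omega,\gamma)\subset L^1(\Omega)$ (in particular when $\gamma\le 0$), $L^p_0(\Omega,\gamma)$ is the subspace of $L^p(\Omega,\gamma)$ of functions with vanishing mean value, $\int_\Omega f=0$. $W^{1,p}_0(\Omega)$ is the closure of $C_0^\infty(\Omega)$ in the (unweighted) space $W^{1,p}(\Omega)$. ''$\operatorname{div}:W^{1,p}_0(\Omega)^2\to L^p_0(\Omega,\beta)$ admits a continuous right inverse'' means: there is a constant $C$ such that for every $f\in L^p_0(\Omega,\beta)$ there exists $\mathbf{u}\in W^{1,p}_0(\Omega)^2$ with $\operatorname{div}\mathbf{u}=f$ and $\|\mathbf{u}\|_{W^{1,p}(\Omega)}\le C\|f\|_{L^p(\Omega,\beta)}$. (It is not required that $\operatorname{div}$ map all of $W^{1,p}_0(\Omega)^2$ into $L^p_0(\Omega,\beta)$.) *)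

(* Defs.v *)
From HB Require Import structures.
From mathcomp Require Import all_boot all_order all_algebra.
From mathcomp Require Import all_classical all_reals all_analysis.
Import Order.TTheory GRing.Theory Num.Theory.
Import numFieldNormedType.Exports.

Set Implicit Arguments.
Unset Strict Implicit.
Unset Printing Implicit Defensive.

Local Open Scope classical_set_scope.
Local Open Scope ring_scope.

Section planar_sobolev.
Context {R : realType}.
Implicit Types (Om : set (R * R)) (p gamma : R) (f u v phi : R * R -> R).

Definition leb2 :
    {measure set (measurableTypeR R * measurableTypeR R) -> \bar R} :=
  (@lebesgue_measure R \x @lebesgue_measure R)%E.

(* Only the values of a function on Om matter: functions on Om are
   represented by functions on the plane, extended by 0 outside Om. *)
Definition Lpnorm Om p f : \bar R := 'N[leb2]_(p%:E)[EFin \o (f \_ Om)]%E.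

Definition inLp Om p f : Prop := f \_ Om \in Lfun leb2 p%:E.

Definition boundary Om : set (R * R) := closure Om `\` Om°.

(* The norm of the library on R * R is the sup norm, hence this definition. *)
Definition eucl_dist (x y : R * R) : R :=
  Num.sqrt ((x.1 - y.1) ^+ 2 + (x.2 - y.2) ^+ 2).

Definition bdist Om (x : R * R) : R :=
  inf [set eucl_dist x y | y in boundary Om].

Definition weighted Om gamma f : R * R -> R :=
  fun x => f x * bdist Om x `^ gamma.

(* The integral below is the extended one, which is not 0 when the positive
   and the negative part of f both have infinite integral: f is integrable. *)
Definition inLp0 Om p gamma f : Prop :=
  [/\ measurable_fun Om f,
      inLp Om p (weighted Om gamma f) &
      (\int[leb2]_(x in Om) (f x)%:E = 0)%E].

Definition evec (i : 'I_2) : R * R := if i == ord0 then (1, 0) else (0, 1).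

Definition partial (i : 'I_2) phi : R * R -> R := 'D_(evec i) phi.

Fixpoint is_Ck (k : nat) phi : Prop :=
  continuous phi /\
  if k is k'.+1 then
    forall i : 'I_2,
      (forall x, derivable phi x (evec i)) /\ is_Ck k' (partial i phi)
  else True.

Definition is_smooth phi : Prop := forall k, is_Ck k phi.

Definition tsupport phi : set (R * R) := closure [set x | phi x != 0].

Definition test_function Om phi : Prop :=
  [/\ is_smooth phi, compact (tsupport phi) & tsupport phi `<=` Om].

Definition is_weak_partial Om (i : 'I_2) u v : Prop :=
  forall phi, test_function Om phi ->
    \int[leb2]_(x in Om) (u x * partial i phi x) =
    - \int[leb2]_(x in Om) (v x * phi x).

(* Weak gradients being unique only almost everywhere, an element of W^{1,p}
   is represented by u together with (a version of) its weak gradient Du. *)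
Definition inW1p Om p u (Du : 'I_2 -> R * R -> R) : Prop :=
  inLp Om p u /\
  forall i, inLp Om p (Du i) /\ is_weak_partial Om i u (Du i).

Definition W1pnorm Om p u (Du : 'I_2 -> R * R -> R) : \bar R :=
  ((Lpnorm Om p u `^ p + \sum_(i < 2) Lpnorm Om p (Du i) `^ p) `^ p^-1)%E.

Definition inW1p0 Om p u (Du : 'I_2 -> R * R -> R) : Prop :=
  inW1p Om p u Du /\
  forall e : R, 0 < e -> exists2 phi, test_function Om phi &
    (W1pnorm Om p (u \- phi)%R (fun i => (Du i \- partial i phi)%R) < e%:E)%E.

Definition W1pnorm_vec Om p (u : 'I_2 -> R * R -> R)
    (Du : 'I_2 -> 'I_2 -> R * R -> R) : \bar R :=
  ((\sum_(i < 2) W1pnorm Om p (u i) (Du i) `^ p) `^ p^-1)%E.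

(* Du i j is the weak derivative of the i-th component in the j-th variable. *)
Definition div_has_continuous_right_inverse Om p beta : Prop :=
  exists C : R, forall f, inLp0 Om p beta f ->
    exists (u : 'I_2 -> R * R -> R) (Du : 'I_2 -> 'I_2 -> R * R -> R),
      [/\ forall i, inW1p0 Om p (u i) (Du i),
          {ae leb2, forall x, Om x -> \sum_(i < 2) Du i i x = f x} &
          (W1pnorm_vec Om p u Du <=
             C%:E * Lpnorm Om p (weighted Om beta f))%E].

Definition cusp (alpha : R) : set (R * R) :=
  [set z | 0 < z.1 < 1 /\ `|z.2| < z.1 `^ alpha^-1].

End planar_sobolev.

(* Main.v *)
Require Import Defs.
From mathcomp Require Import all_boot all_order all_algebra.
From mathcomp Require Import all_classical all_reals all_analysis.
From mathcomp Require Import measurable_realfun.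
From mathcomp Require Import ring lra.
Import Order.TTheory GRing.Theory Num.Theory.
Import numFieldNormedType.Exports.

(** Write g = 1 / alpha, so that the section of the cusp at abscissa x is the
    interval |y| < x^g, and suppose beta > alpha - 1.  A field with
    divergence f has to carry the mass of f through narrow sections, at whose
    ends it vanishes, and this makes its gradient large.

    For 0 < s <= 1/2, let w = (s/8)^g and let f be the indicator function of
    the rectangle [s/4, s/2] x [-w/2, w/2] minus that of its translate
    [s, 5s/4] x [-w/2, w/2] ([dipole]).  Both rectangles are at distance at
    least w/2 from the boundary, f has mean value zero, and
    || f d^beta ||_p <= (w/2)^beta (s w / 2)^(1/p), by
    [Lpnorm_weighted_dipole].

    Let eta(x) = max(s - x, 0)^2 ([cutoff]), which vanishes on the second
    rectangle.  If u is a test vector field in the cusp, then integrating the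
    x-derivative along horizontal lines and the y-derivatives along vertical
    lines gives
      int eta div u = - int eta' u_1 = int y eta' d_2 u_1.
    Both ends are continuous in the L^p norm of the gradient, so the identity
    holds for every u in W^{1,p}_0 ([inW1p0_integral_eq0],
    [cutoff_integral_identity]).  Where eta' is not zero, |y eta'| is at most
    2 s s^g, and the part of the cusp where x < s has measure at most
    L = 2 s s^g.  If div u = f, Hoelder's inequality and the continuity of the
    right inverse therefore yield ([right_inverse_scale_inequality])
      (s^2/4) (s w / 4) <= int eta f
        <= L L^(1 - 1/p) C (w/2)^beta (s w / 2)^(1/p).
    All powers of s that depend on p cancel, and what remains is
    s <= K s^(g (1 + beta)) ([scale_inequality_cancel]).  Since
    g (1 + beta) > 1, this fails as s tends to 0. *)

Set Implicit Arguments.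
Unset Strict Implicit.
Unset Printing Implicit Defensive.
Local Open Scope classical_set_scope.
Local Open Scope ring_scope.

(** The plane with the product of the Borel sigma-algebras of its factors. *)
Notation plane R := (measurableTypeR R * measurableTypeR R)%type.

(** * Measurability on the plane, integrals of derivatives *)

(** Open sets of the plane are Borel for the product structure: they are
    countable unions of rational boxes. *)
Lemma open_measurable_plane (R : realType) (U : set (R * R)) :
  open U -> measurable (U : set (plane R)).
Proof.
move=> oU.
pose box (q : rat * rat * rat) : set (plane R) :=
  `]ratr q.1.1 - ratr q.2, ratr q.1.1 + ratr q.2[ `*`
  `]ratr q.1.2 - ratr q.2, ratr q.1.2 + ratr q.2[.
have -> : (U : set (plane R)) =
    \bigcup_q (if `[< box q `<=` U >] then box q else set0).
  apply/seteqP; split=> [[x y] Uxy | z [q _]]; last first.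
    by case: asboolP => // + bz; exact.
  have /nbhs_ballP[e /= e0 eU] := open_nbhs_nbhs (conj oU Uxy).
  have [r /[!in_itv]/= /andP[r0 re]] :
      exists r : rat, ratr r \in `](0:R), e / 2[.
    by apply: rat_in_itvoo; rewrite divr_gt0.
  have near_rat (t : R) : exists q : rat, ratr q \in `]t - ratr r, t + ratr r[.
    by apply: rat_in_itvoo; lra.
  have [qx /[!in_itv]/= /andP[qx1 qx2]] := near_rat x.
  have [qy /[!in_itv]/= /andP[qy1 qy2]] := near_rat y.
  exists (qx, qy, r) => //; case: asboolP => [_|[]].
    by split=> /=; rewrite in_itv/=; apply/andP; split; lra.
  move=> [a b] [/= /[!in_itv]/= /andP[a1 a2] /andP[b1 b2]].
  apply: eU; split; rewrite /ball/= ltr_norml; apply/andP; split; lra.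
apply: countable_bigcupT_measurable => //= q.
by case: asboolP => _ //; apply: measurableX; exact: measurable_itv.
Qed.

Lemma continuous_measurable_plane (R : realType) (f : R * R -> R) :
  continuous f -> measurable_fun setT (f : plane R -> R).
Proof.
move=> /continuousP cf.
apply: (measurability _ (measurable_realfun.RGenOpens.measurableE R)).
move=> _ [_ [a [b ->] <-]].
rewrite setTI; apply: open_measurable_plane; apply: cf; exact: interval_open.
Qed.



(** The integral over the line of the derivative of a compactly supported
    function of class C^1. *)
Lemma integral_derive_compact (R : realType) (F f : R -> R) (M : R) :
  continuous f -> (forall x : R, is_derive x (1 : R) F (f x)) ->
  (forall x, M <= `|x| -> F x = 0 /\ f x = 0) ->
  (\int[@lebesgue_measure R]_x (f x)%:E = 0)%E.
Proof.
move=> cf Ff M0.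
(* The fundamental theorem of calculus needs a nondegenerate interval. *)
pose N : R := `|M| + 1.
have N0 : 0 < N by rewrite /N ltr_wpDl.
have MN : M <= N by rewrite /N; have := ler_norm M; lra.
have FN x : N <= `|x| -> F x = 0 by move=> Nx; exact: (M0 x (le_trans MN Nx)).1.
have cF : continuous F.
  by move=> x; apply/differentiable_continuous/derivable1_diffP/ex_derive.
transitivity (\int[@lebesgue_measure R]_(x in `[(- N)%R, N%R]) (f x)%:E)%E.
  rewrite [RHS]integral_mkcond; apply: eq_integral => x _.
  rewrite patchE; case: ifPn => // /negP xN.
  rewrite (M0 x _).2//; apply: (le_trans MN); rewrite leNgt; apply/negP => xlt.
  by apply: xN; rewrite inE/= in_itv/= -ler_norml ltW.
rewrite (@continuous_FTC2 _ f F).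
- by rewrite !FN ?normrN ?subee// ger0_norm// ltW.
- by lra.
- exact: continuous_subspaceT.
- split; first by move=> x _; apply: ex_derive; exact: Ff.
    by apply: cvg_at_right_filter; exact: cF.
  by apply: cvg_at_left_filter; exact: cF.
- by move=> x _; rewrite derive1E; exact: derive_val.
Qed.

Lemma integrable_bounded (R : realType) d (T : measurableType d)
    (mu : {measure set T -> \bar R}) (D : set T) (h : T -> R) (N : R) :
  measurable D -> (mu D < +oo)%E -> measurable_fun D h ->
  (forall x, D x -> `|h x| <= N) ->
  mu.-integrable D (EFin \o h).
Proof.
move=> mD Dfin mh hN.
apply: measurable_bounded_integrable => //.
exists `|N|; split; first exact: num_real.
move=> x Nx z Dz /=; apply: (le_trans (hN _ Dz)).
by apply: ltW; apply: (le_lt_trans (ler_norm N)).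
Qed.

Lemma leb2_box (R : realType) (a b c d : R) : a <= b -> c <= d ->
  (leb2 (`[a, b]%classic `*` `[c, d]%classic : set (plane R)) =
     ((b - a) * (d - c))%:E)%E.
Proof.
move=> ab cd; rewrite [LHS]product_measure1E; try exact: measurable_itv.
have leI (x y : R) : x <= y -> @lebesgue_measure R `[x, y] = (y - x)%:E.
  rewrite le_eqVlt lebesgue_measure_itv/= lte_fin => /predU1P[->|->].
    by rewrite ltxx subrr.
  by rewrite EFinB.
by rewrite EFinM -(leI a b)// -(leI c d).
Qed.

(** * Integrals of bounded functions on the plane, test functions *)

Lemma integrable_plane_bounded (R : realType) (h : plane R -> R) (M N : R) :
  measurable_fun setT h -> (forall z, `|h z| <= N) ->
  (forall z : R * R, M <= `|z| -> h z = 0) ->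
  (@leb2 R).-integrable setT (EFin \o h).
Proof.
move=> mh hN hM.
pose B : set (plane R) :=
  `[(- `|M|)%R, `|M|%R]%classic `*` `[(- `|M|)%R, `|M|%R]%classic.
have mB : measurable B by apply: measurableX; exact: measurable_itv.
have -> : EFin \o h = (EFin \o h) \_ B.
  apply/funext => z; rewrite patchE; case: ifPn => // /negP zB.
  rewrite /= hM// leNgt; apply/negP => zM; apply: zB; rewrite inE.
  case: z zM => x y; rewrite prod_normE/= gt_max => /andP[xM yM].
  by split => /=; rewrite in_itv/= -ler_norml (le_trans (ltW _) (ler_norm M)).
apply/(integrable_mkcond _ mB).
apply: (@integrable_bounded _ _ _ _ _ _ N) => //; last exact: measurable_funTS.
have NM : - `|M| <= `|M| by have := normr_ge0 M; lra.
by rewrite /B leb2_box// ltry.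
Qed.

Lemma integral_plane_slice1 (R : realType) (h : plane R -> R) :
  (@leb2 R).-integrable setT (EFin \o h) ->
  (forall x, \int[@lebesgue_measure R]_y (h (x, y))%:E = 0)%E ->
  (\int[@leb2 R]_z (h z)%:E = 0)%E.
Proof.
move=> ih h0; rewrite -(integral12_prod_meas1 ih) /fubini_F /=.
by under eq_integral do rewrite h0; rewrite integral0.
Qed.

Lemma integral_plane_slice2 (R : realType) (h : plane R -> R) :
  (@leb2 R).-integrable setT (EFin \o h) ->
  (forall y, \int[@lebesgue_measure R]_x (h (x, y))%:E = 0)%E ->
  (\int[@leb2 R]_z (h z)%:E = 0)%E.
Proof.
move=> ih h0; rewrite -(integral21_prod_meas1 ih) /fubini_G /=.
by under eq_integral do rewrite h0; rewrite integral0.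
Qed.

Section test_functions.
Context {R : realType}.
Implicit Types (Om : set (R * R)) (phi : R * R -> R).

Lemma test_function_continuous Om phi : test_function Om phi -> continuous phi.
Proof. by move=> [/(_ 0%N)[]]. Qed.

Lemma test_function_partial_continuous Om phi (i : 'I_2) :
  test_function Om phi -> continuous (partial i phi).
Proof. by move=> [/(_ 1%N)[_ /(_ i)[_ []]]]. Qed.

Lemma test_function_derivable Om phi (i : 'I_2) z :
  test_function Om phi -> derivable phi z (evec i).
Proof. by move=> [/(_ 1%N)[_ /(_ i)[]]]. Qed.

Lemma notin_tsupport phi z : ~ tsupport phi z -> phi z = 0.
Proof.
move=> pz; apply/eqP; apply: contra_notT pz => pz.
exact: subset_closure.
Qed.

Lemma partial_notin_tsupport phi (i : 'I_2) z :
  ~ tsupport phi z -> partial i phi z = 0.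
Proof.
move=> pz; rewrite /partial (near_eq_derive _ (g := cst 0)) ?derive_cst//.
have : nbhs z (~` tsupport phi).
  by apply: open_nbhs_nbhs; split=> //; exact/closed_openC/closed_closure.
by apply: filterS => t /notin_tsupport.
Qed.

Lemma compact_norm_bounded (V : normedModType R) (A : set V) :
  compact A -> exists M : R, forall z, A z -> `|z| < M.
Proof.
move=> /compact_bounded[M [_ AM]]; exists (M + 2) => z Az.
have MM : M < M + 1 by lra.
by apply: le_lt_trans (AM _ MM z Az) _; lra.
Qed.

Lemma test_function_support Om phi : test_function Om phi ->
  exists M : R, forall z : R * R, M <= `|z| -> ~ tsupport phi z.
Proof.
move=> [_ /compact_norm_bounded[M KM] _]; exists M => z Mz /KM.
by rewrite ltNge Mz.
Qed.

Lemma bounded_on_tsupport Om phi (g : R * R -> R) : test_function Om phi ->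
  continuous g -> (forall z, ~ tsupport phi z -> g z = 0) ->
  exists N : R, forall z, `|g z| <= N.
Proof.
move=> [_ cK _] cg g0.
have : compact (g @` tsupport phi).
  by apply: continuous_compact => //; exact: continuous_subspaceT.
move=> /compact_norm_bounded[N KN]; exists `|N| => z.
have [Kz|/g0->] := pselect (tsupport phi z); last by rewrite normr0.
by rewrite (le_trans (ltW (KN _ _)) (ler_norm _))//; exists z.
Qed.

(** Differentiability along the coordinate vectors is differentiability of
    the one-variable slices, to which the fundamental theorem of calculus
    applies. *)
Lemma is_derive_slice1 Om phi (x y : R) : test_function Om phi ->
  is_derive x (1 : R) (fun t => phi (t, y)) (partial ord0 phi (x, y)).
Proof.
move=> /(@test_function_derivable Om phi ord0 (x, y)).
have e : (fun h : R =>
      h^-1 *: ((phi \o shift (x, y)) (h *: evec ord0) - phi (x, y))) =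
    (fun h : R => h^-1 *:
      (((fun t => phi (t, y)) \o shift x) (h *: (1 : R)) - phi (x, y))).
  apply/funext => h; rewrite /= /evec/=; congr (_ *: (phi _ - _)).
  by congr pair; rewrite /= scaler0 add0r.
rewrite /partial /derivable /derive e => cG; split => //.
Qed.

Lemma is_derive_slice2 Om phi (x y : R) : test_function Om phi ->
  is_derive y (1 : R) (fun t => phi (x, t)) (partial ord_max phi (x, y)).
Proof.
move=> /(@test_function_derivable Om phi ord_max (x, y)).
have e : (fun h : R =>
      h^-1 *: ((phi \o shift (x, y)) (h *: evec ord_max) - phi (x, y))) =
    (fun h : R => h^-1 *:
      (((fun t => phi (x, t)) \o shift y) (h *: (1 : R)) - phi (x, y))).
  apply/funext => h; rewrite /= /evec/=; congr (_ *: (phi _ - _)).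
  by congr pair; rewrite /= scaler0 add0r.
rewrite /partial /derivable /derive e => cG; split => //.
Qed.

End test_functions.

(** * Integration by parts against test functions *)

Section test_identities.
Context {R : realType}.
Implicit Types (Om : set (R * R)) (phi : R * R -> R).

Lemma integrable_on_tsupport Om phi (h : R * R -> R) : test_function Om phi ->
  continuous h -> (forall z, ~ tsupport phi z -> h z = 0) ->
  (@leb2 R).-integrable setT (EFin \o h).
Proof.
move=> tphi ch h0; have [N hN] := bounded_on_tsupport tphi ch h0.
have [M hM] := test_function_support tphi.
apply: (@integrable_plane_bounded _ _ M N) => //.
  exact: continuous_measurable_plane.
by move=> z /hM /h0.
Qed.

Lemma continuous_comp1 (a : R -> R) : continuous a ->
  continuous (fun z : R * R => a z.1).
Proof. by move=> ca z; apply: continuous_comp; [exact: cvg_fst|exact: ca]. Qed.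

Lemma continuous_comp2 (a : R -> R) : continuous a ->
  continuous (fun z : R * R => a z.2).
Proof. by move=> ca z; apply: continuous_comp; [exact: cvg_snd|exact: ca]. Qed.

Lemma continuous_slice1 (h : R * R -> R) (y : R) : continuous h ->
  continuous (fun x => h (x, y)).
Proof.
move=> ch x; apply: (@continuous_comp _ _ _ (fun x : R => (x, y)) h);
  last exact: ch.
by apply: (@cvg_pair _ _ _ _ (nbhs x) (nbhs y)); [exact: cvg_id|exact: cvg_cst].
Qed.

Lemma continuous_slice2 (h : R * R -> R) (x : R) : continuous h ->
  continuous (fun y => h (x, y)).
Proof.
move=> ch y; apply: (@continuous_comp _ _ _ (fun y : R => (x, y)) h);
  last exact: ch.
by apply: (@cvg_pair _ _ _ _ (nbhs x) (nbhs y)); [exact: cvg_cst|exact: cvg_id].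
Qed.

Lemma is_derive_continuous (a a' : R -> R) :
  (forall x : R, is_derive x (1 : R) a (a' x)) -> continuous a.
Proof.
by move=> da x; apply/differentiable_continuous/derivable1_diffP/ex_derive.
Qed.

Variables (a a' c : R -> R).
Hypotheses (da : forall x : R, is_derive x (1 : R) a (a' x)).
Hypotheses (ca' : continuous a') (cc : continuous c).

Let ca : continuous a := is_derive_continuous da.

Let h1 phi z := c z.2 * (a' z.1 * phi z + a z.1 * partial ord0 phi z).
Let h2 phi z := c z.1 * (a' z.2 * phi z + a z.2 * partial ord_max phi z).

(** [h1 phi] is c(y) d/dx (a(x) phi(x, y)). *)
Lemma test_function_int_by_parts1 Om phi : test_function Om phi ->
  (@leb2 R).-integrable setT (EFin \o h1 phi) /\
  (\int[@leb2 R]_z (h1 phi z)%:E = 0)%E.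
Proof.
move=> tphi.
have cp := test_function_continuous tphi.
have cd := @test_function_partial_continuous _ _ _ ord0 tphi.
have ch : continuous (h1 phi).
  move=> z; apply: cvgM; first exact: (continuous_comp2 cc).
  apply: cvgD; apply: cvgM; [exact: (continuous_comp1 ca')|exact: cp
    |exact: (continuous_comp1 ca)|exact: cd ].
have h0 z : ~ tsupport phi z -> h1 phi z = 0.
  move=> pz; rewrite /h1 (notin_tsupport pz) (partial_notin_tsupport _ pz).
  by rewrite !mulr0 addr0 mulr0.
have ih := integrable_on_tsupport tphi ch h0.
split=> //; apply: integral_plane_slice2 => // y.
have [M hM] := test_function_support tphi.
apply: (@integral_derive_compact _ (fun x => c y * (a x * phi (x, y))) _ M).
- exact: continuous_slice1.
- move=> x; have d1 := is_derive_slice1 x y tphi; have d2 := da x.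
  have -> : h1 phi (x, y) =
      c y *: (a x *: partial ord0 phi (x, y) + phi (x, y) *: a' x).
    by rewrite /h1/= /GRing.scale/=; ring.
  exact: (is_deriveZ (c y) (is_deriveM d2 d1)).
- move=> x Mx; have xM : M <= `|(x, y) : R * R|.
    by rewrite prod_normE/= le_max Mx.
  by have pz := hM _ xM; rewrite h0// (notin_tsupport pz) !mulr0.
Qed.

(** [h2 phi] is c(x) d/dy (a(y) phi(x, y)). *)
Lemma test_function_int_by_parts2 Om phi : test_function Om phi ->
  (@leb2 R).-integrable setT (EFin \o h2 phi) /\
  (\int[@leb2 R]_z (h2 phi z)%:E = 0)%E.
Proof.
move=> tphi.
have cp := test_function_continuous tphi.
have cd := @test_function_partial_continuous _ _ _ ord_max tphi.
have ch : continuous (h2 phi).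
  move=> z; apply: cvgM; first exact: (continuous_comp1 cc).
  apply: cvgD; apply: cvgM; [exact: (continuous_comp2 ca')|exact: cp
    |exact: (continuous_comp2 ca)|exact: cd ].
have h0 z : ~ tsupport phi z -> h2 phi z = 0.
  move=> pz; rewrite /h2 (notin_tsupport pz) (partial_notin_tsupport _ pz).
  by rewrite !mulr0 addr0 mulr0.
have ih := integrable_on_tsupport tphi ch h0.
split=> //; apply: integral_plane_slice1 => // x.
have [M hM] := test_function_support tphi.
apply: (@integral_derive_compact _ (fun y => c x * (a y * phi (x, y))) _ M).
- exact: continuous_slice2.
- move=> y; have d1 := is_derive_slice2 x y tphi; have d2 := da y.
  have -> : h2 phi (x, y) =
      c x *: (a y *: partial ord_max phi (x, y) + phi (x, y) *: a' y).
    by rewrite /h2/= /GRing.scale/=; ring.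
  exact: (is_deriveZ (c x) (is_deriveM d2 d1)).
- move=> y My; have yM : M <= `|(x, y) : R * R|.
    by rewrite prod_normE/= le_max My orbT.
  by have pz := hM _ yM; rewrite h0// (notin_tsupport pz) !mulr0.
Qed.

End test_identities.

Lemma integral_test_restrict (R : realType) Om phi (h : R * R -> R) :
  test_function Om phi -> (forall z, ~ tsupport phi z -> h z = 0) ->
  (\int[@leb2 R]_(z in Om) (h z)%:E = \int[@leb2 R]_z (h z)%:E)%E.
Proof.
move=> [_ _ KOm] h0; rewrite [LHS]integral_mkcond; apply: eq_integral => z _.
rewrite patchE; case: ifPn => // /negP zOm; rewrite h0// => /KOm Omz.
by apply: zOm; rewrite inE.
Qed.

Section first_variable_weight.
Context {R : realType}.
Variables (eta eta' : R -> R).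
Hypotheses (deta : forall x : R, is_derive x (1 : R) eta (eta' x)).
Hypothesis ceta' : continuous eta'.

Lemma integral_weight_partial2 Om phi : test_function Om phi ->
  (\int[@leb2 R]_(z in Om) (eta z.1 * partial ord_max phi z)%:E = 0)%E.
Proof.
move=> tphi; rewrite (integral_test_restrict tphi); last first.
  by move=> z /partial_notin_tsupport ->; rewrite mulr0.
have ceta := is_derive_continuous deta.
have d1 (x : R) : is_derive x (1 : R) (cst (1 : R)) (cst 0 x).
  exact: is_derive_cst.
have c0 : continuous (cst 0 : R -> R) by move=> x; exact: cvg_cst.
have [_ <-] := test_function_int_by_parts2 d1 c0 ceta tphi.
by apply: eq_integral => z _; rewrite /= mul0r mul1r add0r.
Qed.

(** The integrand is d/dx (eta phi) - d/dy (y eta' phi). *)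
Lemma integral_weight_partial1 Om phi : test_function Om phi ->
  (\int[@leb2 R]_(z in Om) (eta z.1 * partial ord0 phi z
     + (- (z.2 * eta' z.1)) * partial ord_max phi z)%:E = 0)%E.
Proof.
move=> tphi; rewrite (integral_test_restrict tphi); last first.
  by move=> z pz; rewrite !partial_notin_tsupport// !mulr0 addr0.
have ceta := is_derive_continuous deta.
have c1 : continuous (cst 1 : R -> R) by move=> x; exact: cvg_cst.
have did (x : R) : is_derive x (1 : R) (@id R) (cst 1 x) by exact: is_derive_id.
have [i1 e1] := test_function_int_by_parts1 deta ceta' c1 tphi.
have [i2 e2] := test_function_int_by_parts2 did c1 ceta' tphi.
transitivity (0 - 0 : \bar R)%E; last by rewrite sube0.
rewrite -{1}e1 -e2 -integralB//; apply: eq_integral => z _.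
by rewrite /= -EFinB; congr EFin; ring.
Qed.

End first_variable_weight.

(** * Hoelder's inequality and passage to the limit in W^{1,p}_0 *)

(** Hoelder's inequality with the indicator function of [D]. *)
Lemma hoelder_on_set (R : realType) d (T : measurableType d)
    (mu : {measure set T -> \bar R}) (D : set T) (v : T -> R) (p : R) :
  1 < p -> measurable D -> measurable_fun setT v ->
  (\int[mu]_(x in D) `|v x|%:E <=
     mu D `^ (1 - p^-1) * 'N[mu]_(p%:E)[EFin \o v])%E.
Proof.
move=> p1 mD mv.
have p0 : 0 < p by lra.
have ip : p^-1 < 1 by rewrite invf_lt1.
have q0 : 0 < (1 - p^-1)^-1 by rewrite invr_gt0 subr_gt0.
have pq : (1 - p^-1)^-1^-1 + p^-1 = 1 by rewrite invrK subrK.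
have mI : measurable_fun setT (\1_D : T -> R) by exact: measurable_indic.
have := @hoelder _ _ _ mu _ _ _ _ mI mv q0 p0 pq.
rewrite Lnorm1.
have -> : (\int[mu]_x `|(EFin \o (\1_D \* v)%R) x|
    = \int[mu]_(x in D) `|v x|%:E)%E.
  rewrite [RHS]integral_mkcond; apply: eq_integral => x _.
  rewrite patchE /= indicE; case: ifPn => _; first by rewrite mul1r.
  by rewrite mul0r normr0.
move=> /le_trans; apply; rewrite lee_wpmul2r ?Lnorm_ge0//.
rewrite unlock invrK.
have -> : (\int[mu]_x `|(EFin \o \1_D) x| `^ (1 - p^-1)^-1
    = \int[mu]_x (\1_D x)%:E)%E.
  apply: eq_integral => x _; rewrite /= indicE.
  by case: (x \in D); rewrite ?normr1 ?powR1// normr0 powR0// gt_eqF.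
by rewrite integral_indic// setIT.
Qed.

Lemma abse_integral_mul_bounded (R : realType) d (T : measurableType d)
    (mu : {measure set T -> \bar R}) (D : set T) (g v : T -> R) (N : R) :
  measurable D -> measurable_fun D g -> measurable_fun D v ->
  0 <= N -> (forall x, D x -> `|g x| <= N) ->
  (`| \int[mu]_(x in D) (g x * v x)%:E | <=
     N%:E * \int[mu]_(x in D) `|v x|%:E)%E.
Proof.
move=> mD mg mv N0 gN.
have mgv : measurable_fun D (fun x => g x * v x) by exact: measurable_funM.
apply: le_trans; first by apply: le_abse_integral => //; exact/measurable_EFinP.
rewrite -ge0_integralZl//=; last first.
  by apply/measurable_EFinP; exact: measurableT_comp.
apply: ge0_le_integral => //.
- by apply/measurable_EFinP; exact: measurableT_comp.
- apply/measurable_EFinP; apply: measurable_funM; first exact: measurable_cst.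
  exact: measurableT_comp.
- by move=> x Dx; rewrite -EFinM lee_fin normrM ler_wpM2r// gN.
Qed.

Section sobolev_norms.
Context {R : realType}.
Variables (Om : set (plane R)) (p : R).
Hypotheses (p1 : 1 < p) (mOm : measurable Om).

Lemma integral_le_Lpnorm (D : set (plane R)) (v : R * R -> R) :
  measurable D -> D `<=` Om -> measurable_fun Om (v : plane R -> R) ->
  (\int[@leb2 R]_(z in D) `|v z|%:E <=
     @leb2 R D `^ (1 - p^-1) * Lpnorm Om p v)%E.
Proof.
move=> mD DOm mv.
have mv' : measurable_fun setT ((v \_ Om) : plane R -> R).
  by apply/(measurable_restrictT _ _).1.
apply: le_trans (hoelder_on_set (@leb2 R) p1 mD mv').
rewrite le_eqVlt; apply/orP; left; apply/eqP.
by apply: eq_integral => z /set_mem zD; rewrite patchE mem_set//; exact: DOm.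
Qed.

Lemma inLp_measurable (v : R * R -> R) : inLp Om p v ->
  measurable_fun Om (v : plane R -> R).
Proof.
move=> /sub_Lfun_mfun; rewrite inE => mv; exact/(measurable_restrictT _ _).2.
Qed.

Lemma inLp_lty (v : R * R -> R) : inLp Om p v -> (Lpnorm Om p v < +oo)%E.
Proof. by move=> /sub_Lfun_finLfun; rewrite inE. Qed.

Lemma inLp_integrable (v : R * R -> R) : (@leb2 R Om < +oo)%E ->
  inLp Om p v -> (@leb2 R).-integrable Om (EFin \o v).
Proof.
move=> Omfin vp; apply/integrableP; split.
  by apply/measurable_EFinP; exact: inLp_measurable.
apply: le_lt_trans (integral_le_Lpnorm mOm _ (inLp_measurable vp)) _ => //.
rewrite lte_mul_pinfty ?poweR_ge0//; last exact: inLp_lty.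
by rewrite ge0_fin_numE ?poweR_ge0// poweR_lty.
Qed.

Lemma le_poweRV (x y : \bar R) : (0 <= x)%E -> (x `^ p <= y)%E ->
  (x <= y `^ p^-1)%E.
Proof.
have p0 : 0 < p by exact: lt_trans p1.
move=> x0 xy.
rewrite -[leLHS]poweRe1// -(@mulfV _ p) ?gt_eqF// poweRrM.
apply: gt0_ler_poweR => //; first by rewrite invr_ge0 ltW.
- by rewrite in_itv/= poweR_ge0 leey.
- by rewrite in_itv/= (le_trans _ xy) ?poweR_ge0// leey.
Qed.

Lemma Lpnorm_partial_le_W1pnorm (u : R * R -> R) (Du : 'I_2 -> R * R -> R) i :
  (Lpnorm Om p (Du i) <= W1pnorm Om p u Du)%E.
Proof.
apply: le_poweRV; first exact: Lnorm_ge0.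
rewrite (bigD1 i)//= addeCA leeDl// adde_ge0 ?poweR_ge0//.
by apply: sume_ge0 => j _; exact: poweR_ge0.
Qed.

Lemma W1pnorm_le_W1pnorm_vec (u : 'I_2 -> R * R -> R) Du i :
  (W1pnorm Om p (u i) (Du i) <= W1pnorm_vec Om p u Du)%E.
Proof.
apply: le_poweRV; first exact: poweR_ge0.
rewrite (bigD1 i)//= leeDl//.
by apply: sume_ge0 => j _; exact: poweR_ge0.
Qed.

(** A linear functional of the gradient with bounded coefficients that
    vanishes on test functions also vanishes on W^{1,p}_0, since it is continuous
    for the L^p norm of the gradient and [Du] is an L^p limit of gradients of
    test functions. *)
Lemma inW1p0_integral_eq0 (g : 'I_2 -> R * R -> R) (N : R)
    (u : R * R -> R) (Du : 'I_2 -> R * R -> R) :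
  (@leb2 R Om < +oo)%E ->
  (forall i, measurable_fun Om (g i : plane R -> R)) ->
  (forall i z, Om z -> `|g i z| <= N) ->
  (forall phi, test_function Om phi ->
     \int[@leb2 R]_(z in Om)
       (\sum_(i < 2) g i z * partial i phi z)%:E = 0)%E ->
  inW1p0 Om p u Du ->
  (\int[@leb2 R]_(z in Om) (\sum_(i < 2) g i z * Du i z)%:E = 0)%E.
Proof.
move=> Omfin mg gN g0 [[_ DuLp] dens].
have gN' i z : Om z -> `|g i z| <= `|N|.
  by move=> Oz; rewrite (le_trans (gN i z Oz)) ?ler_norm.
have gb i : [bounded g i z | z in Om].
  exists `|N|; split; first exact: num_real.
  by move=> M NM z Oz /=; rewrite (le_trans (gN' i z Oz)) ?ltW.
set I := (X in X = 0%E).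
set K := (@leb2 R Om `^ (1 - p^-1))%E.
have K0 : (0 <= K)%E by exact: poweR_ge0.
have Kfin : K \is a fin_num by rewrite ge0_fin_numE// poweR_lty.
have Dui i : (@leb2 R).-integrable Om (EFin \o Du i).
  by apply: inLp_integrable => //; exact: (DuLp i).1.
have intg (w : 'I_2 -> R * R -> R) :
    (forall i, (@leb2 R).-integrable Om (EFin \o w i)) ->
    (@leb2 R).-integrable Om (fun z => (\sum_(i < 2) g i z * w i z)%:E).
  move=> wi; under eq_fun do rewrite -sumEFin.
  apply: integrable_sum => // i _.
  exact: (integrableMr mOm (mg i) (gb i) (wi i)).
have Ile e : 0 < e -> (`|I| <= (`|N| * fine K * 2 * e)%:E)%E.
  move=> e0; have [phi tphi phie] := dens e e0.
  have dphi i : (@leb2 R).-integrable Om (EFin \o partial i phi).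
    apply: (@integrableS _ _ _ _ setT) => //.
    apply: (integrable_on_tsupport tphi).
      exact: (test_function_partial_continuous tphi).
    by move=> z; exact: partial_notin_tsupport.
  have mdiff i : measurable_fun Om ((Du i \- partial i phi)%R : plane R -> R).
    apply: measurable_funB; apply/measurable_EFinP.
      exact: (measurable_int _ (Dui i)).
    exact: (measurable_int _ (dphi i)).
  have idiff i : (@leb2 R).-integrable Om (EFin \o (Du i \- partial i phi)%R).
    have := integrableB mOm (Dui i) (dphi i).
    by apply: eq_integrable.
  have -> : I = (\sum_(i < 2) \int[@leb2 R]_(z in Om)
       (g i z * (Du i z - partial i phi z))%:E)%E.
    rewrite -[LHS]sube0 -[X in (_ - X = _)%E](g0 _ tphi) /I.
    rewrite -integralB//; try exact: intg.
    transitivity (\int[@leb2 R]_(z in Om)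
        \sum_(i < 2) (g i z * (Du i z - partial i phi z))%:E)%E; last first.
      rewrite integral_sum// => i.
      exact: (integrableMr mOm (mg i) (gb i) (idiff i)).
    apply: eq_integral => z _; rewrite sumEFin -EFinB; congr EFin.
    by rewrite -sumrB; apply: eq_bigr => i _; rewrite mulrBr.
  apply: (le_trans (lee_abs_sum _ _ _)).
  apply: (@le_trans _ _ (\sum_(i < 2) (`|N| * fine K * e)%:E)%E); last first.
    by rewrite sumEFin lee_fin big_ord_recl big_ord1; lra.
  apply: lee_sum => i _.
  have := abse_integral_mul_bounded (@leb2 R) mOm (mg i) (mdiff i)
    (normr_ge0 N) (gN' i).
  move=> /le_trans; apply; rewrite -mulrA EFinM lee_wpmul2l ?lee_fin//.
  apply: (le_trans (integral_le_Lpnorm mOm _ (mdiff i))) => //.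
  rewrite EFinM fineK// lee_wpmul2l//.
  apply: le_trans (ltW phie); exact: (Lpnorm_partial_le_W1pnorm _ _ i).
have Ifin : I \is a fin_num.
  by apply: integrable_fin_num => //; exact: intg.
apply/eqP; rewrite -abse_eq0 eq_le abse_ge0 andbT.
rewrite -(fineK Ifin)/= lee_fin; apply/ler_addgt0Pr => e e0; rewrite add0r.
set L := `|N| * fine K * 2.
have L0 : 0 <= L by rewrite !mulr_ge0// fine_ge0.
have eL : 0 < e / (L + 1) by rewrite divr_gt0// ltr_wpDl.
have := Ile _ eL; rewrite -(fineK Ifin)/= lee_fin => /le_trans; apply.
rewrite -/L mulrA ler_pdivrMr ?ltr_wpDl// mulrC ler_pM2l//; lra.
Qed.

End sobolev_norms.

(** * Distance to the boundary *)

Lemma eucl_dist_continuous (R : realType) (y : R * R) :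
  continuous (fun z => eucl_dist z y).
Proof.
move=> z; rewrite /eucl_dist.
apply: (@continuous_comp _ _ _
    (fun z : R * R => (z.1 - y.1) ^+ 2 + (z.2 - y.2) ^+ 2) Num.sqrt);
  last exact: sqrt_continuous.
have csq (b : R) : continuous (fun t : R => (t - b) ^+ 2).
  move=> t.
  apply: (@continuous_comp _ _ _ (fun t => t - b) (fun t : R => t ^+ 2)).
    by apply: cvgB; [exact: cvg_id|exact: cvg_cst].
  exact: exprn_continuous.
apply: cvgD; first exact: (@continuous_comp1 _ _ (csq y.1)).
exact: (@continuous_comp2 _ _ (csq y.2)).
Qed.

(** The sublevel sets of the distance to the boundary are unions of Euclidean
    discs. *)
Lemma bdist_measurable (R : realType) (Om : set (R * R)) :
  measurable_fun setT (bdist Om : plane R -> R).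
Proof.
have [B0|/set0P B0] := eqVneq (boundary Om) set0.
  have -> : bdist Om = cst 0.
    by apply/funext => z; rewrite /bdist B0 image_set0 inf0.
  exact: measurable_cst.
apply: (measurability _ (measurable_realfun.RGenInftyO.measurableE R)).
move=> _ [_ [a ->] <-].
rewrite setTI; apply: open_measurable_plane.
rewrite (_ : _ @^-1` _ =
    \bigcup_(y in boundary Om) [set z | eucl_dist z y < a]).
  apply: bigcup_open => y _.
  have /continuousP/(_ `]-oo, a[%classic) := @eucl_dist_continuous R y.
  rewrite (_ : _ @^-1` _ = [set z | eucl_dist z y < a]); last first.
    by apply/seteqP; split => z /=; rewrite in_itv.
  by apply; exact: interval_open.
apply/seteqP; split => [z /=|z [y By /= zy]]; rewrite in_itv/=.
  have : [set eucl_dist z y | y in boundary Om] !=set0.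
    by case: B0 => y By; exists (eucl_dist z y), y.
  by move=> /inf_lt/[apply] -[_ [y By <-] zy]; exists y.
apply: le_lt_trans zy; apply: ge_inf; last by exists y.
by exists 0 => _ [? _ <-]; exact: sqrtr_ge0.
Qed.

Lemma eucl_dist_ge1 (R : realType) (y z : R * R) :
  `|z.1 - y.1| <= eucl_dist y z.
Proof.
rewrite /eucl_dist -sqrtr_sqr ler_wsqrtr//.
have := sqr_ge0 (y.2 - z.2); rewrite -[(z.1 - y.1) ^+ 2]sqrrN opprB; lra.
Qed.

Lemma eucl_dist_ge2 (R : realType) (y z : R * R) :
  `|z.2 - y.2| <= eucl_dist y z.
Proof.
rewrite /eucl_dist -sqrtr_sqr ler_wsqrtr//.
have := sqr_ge0 (y.1 - z.1); rewrite -[(z.2 - y.2) ^+ 2]sqrrN opprB; lra.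
Qed.

(** A point at sup-norm distance at least [d] from the complement of [Om] is
    at Euclidean distance at least [d] from the boundary.  When the boundary is
    empty, [bdist] is 0 by convention and so is its power, unless [b = 0]. *)
Lemma bdist_powR_le (R : realType) (Om : set (R * R)) (z : R * R) (d b : R) :
  0 < d -> b <= 0 ->
  (forall z' : R * R, `|z'.1 - z.1| < d -> `|z'.2 - z.2| < d -> Om z') ->
  bdist Om z `^ b <= d `^ b.
Proof.
move=> d0 b0 zOm.
have [B0|/set0P[y0 By0]] := eqVneq (boundary Om) set0.
  rewrite /bdist B0 image_set0 inf0.
  have [->|bN0] := eqVneq b 0; first by rewrite !powRr0.
  by rewrite powR0// powR_ge0.
have dle : d <= bdist Om z.
  apply: lb_le_inf; first by exists (eucl_dist z y0), y0.
  move=> _ [y [_ nint] <-]; rewrite leNgt; apply/negP => zy; apply: nint.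
  have e0 : 0 < d - eucl_dist z y by rewrite subr_gt0.
  apply/nbhs_ballP; exists (d - eucl_dist z y) => //= z' [].
  rewrite /ball/= => h1 h2; apply: zOm.
    have -> : z'.1 - z.1 = (y.1 - z.1) - (y.1 - z'.1) by lra.
    apply: (le_lt_trans (ler_normB _ _)).
    by have := eucl_dist_ge1 z y; lra.
  have -> : z'.2 - z.2 = (y.2 - z.2) - (y.2 - z'.2) by lra.
  apply: (le_lt_trans (ler_normB _ _)).
  by have := eucl_dist_ge2 z y; lra.
rewrite -[b]opprK !(powRN _ (- b)) lef_pV2 ?posrE ?powR_gt0//;
  last exact: lt_le_trans dle.
by apply: ge0_ler_powR; rewrite ?oppr_ge0 ?nnegrE//;
  [exact: ltW|exact: le_trans (ltW d0) dle].
Qed.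

Lemma Lnorm_le_indic (R : realType) d (T : measurableType d)
    (mu : {measure set T -> \bar R}) (B : set T) (h : T -> R) (K p : R) :
  0 < p -> 0 <= K -> measurable B -> measurable_fun setT h ->
  (forall x, `|h x| <= K * \1_B x) ->
  ('N[mu]_(p%:E)[EFin \o h] <= K%:E * mu B `^ p^-1)%E.
Proof.
move=> p0 K0 mB mh hK; rewrite unlock.
have -> : (K%:E = K%:E `^ p `^ p^-1)%E.
  by rewrite -poweRrM mulfV ?gt_eqF// poweRe1// lee_fin.
rewrite -poweRM ?poweR_ge0//.
apply: gt0_ler_poweR; first by rewrite invr_ge0 ltW.
- rewrite in_itv/= leey andbT; apply: integral_ge0 => x _ /=.
  by rewrite lee_fin powR_ge0.
- by rewrite in_itv/= leey andbT mule_ge0// lee_fin powR_ge0.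
have -> : mu B = (\int[mu]_x (\1_B x)%:E)%E by rewrite integral_indic// setIT.
rewrite poweR_EFin.
rewrite -ge0_integralZl ?lee_fin ?powR_ge0//; last first.
  by apply/measurable_EFinP; exact: measurable_indic.
apply: ge0_le_integral => //.
- by move=> x _; rewrite lee_fin powR_ge0.
- apply/measurable_EFinP.
  apply: (@measurableT_comp _ _ _ _ _ _ (@powR R ^~ p)).
    exact: measurable_powR.
  exact: measurableT_comp.
- apply/measurable_EFinP; apply: measurable_funM; first exact: measurable_cst.
  exact: measurable_indic.
move=> x _; rewrite -EFinM lee_fin; have := hK x; rewrite indicE.
case: (x \in B); rewrite ?mulr1 ?mulr0 => hx.
  by apply: ge0_ler_powR; rewrite ?nnegrE// ltW.
have h0 : `|h x| = 0 by apply/eqP; rewrite eq_le hx normr_ge0.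
by rewrite /= h0 powR0 ?gt_eqF.
Qed.

(** * The cusp and the dipole *)

Section cusp_geometry.
Context {R : realType}.
Variable alpha : R.
Hypothesis alpha01 : 0 < alpha <= 1.

Lemma invalpha_ge1 : 1 <= alpha^-1.
Proof. by case/andP: alpha01 => a0 a1; rewrite invf_ge1. Qed.

Lemma invalpha_ge0 : 0 <= alpha^-1.
Proof. exact: le_trans ler01 invalpha_ge1. Qed.

Lemma measurable_cusp : measurable (cusp alpha : set (plane R)).
Proof.
rewrite (_ : cusp alpha = ((fst : plane R -> R) @^-1` `]0, 1[%classic) `&`
    ((fun z : plane R => `|z.2| < z.1 `^ alpha^-1) @^-1` [set true])).
  apply: measurableI.
    by rewrite -[X in measurable X]setTI; apply: measurable_fst => //;
      exact: measurable_itv.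
  rewrite -[X in measurable X]setTI.
  apply: measurable_fun_ltr => //.
    by apply: measurableT_comp => //; exact: measurable_snd.
  apply: (@measurableT_comp _ _ _ _ _ _ (@powR R ^~ alpha^-1)).
    exact: measurable_powR.
  exact: measurable_fst.
by apply/seteqP; split => z /=; rewrite in_itv.
Qed.

Lemma measurable_cusp_slab (s : R) :
  measurable (cusp alpha `&` [set z | z.1 < s] : set (plane R)).
Proof.
apply: measurableI; first exact: measurable_cusp.
rewrite (_ : [set z | z.1 < s] = (fst : plane R -> R) @^-1` `]-oo, s[%classic).
  by rewrite -[X in measurable X]setTI; apply: measurable_fst => //;
    exact: measurable_itv.
by apply/seteqP; split => z /=; rewrite in_itv.
Qed.

Lemma leb2_cusp_slab (s : R) : 0 < s ->
  (@leb2 R (cusp alpha `&` [set z | (z.1 < s)%R]) <=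
     (2 * s * s `^ alpha^-1)%:E)%E.
Proof.
move=> s0.
have sg0 := powR_ge0 s alpha^-1.
have NN : - s `^ alpha^-1 <= s `^ alpha^-1 by lra.
have -> : ((2 * s * s `^ alpha^-1)%:E = @leb2 R
   (`[0%R, s]%classic `*` `[(- s `^ alpha^-1)%R, (s `^ alpha^-1)%R]%classic))%E.
  by rewrite leb2_box ?(ltW s0)//; congr EFin; ring.
apply: le_measure; rewrite ?inE; first exact: measurable_cusp_slab.
  by apply: measurableX; exact: measurable_itv.
move=> [x y] [[/= /andP[x0 _] yx] xs]; split=> /=; rewrite in_itv/=.
  by rewrite !ltW.
rewrite -ler_norml (le_trans (ltW yx))//.
by apply: ge0_ler_powR; rewrite ?invalpha_ge0 ?nnegrE ?ltW.
Qed.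

Lemma leb2_cusp_lty : (@leb2 R (cusp alpha) < +oo)%E.
Proof.
rewrite (_ : cusp alpha = cusp alpha `&` [set z | z.1 < 1]).
  by apply: le_lt_trans (leb2_cusp_slab ltr01) _; rewrite ltry.
by apply/seteqP; split => [z zc|z []//]; split=> //=; case: zc => /andP[].
Qed.

Variable s : R.
Hypothesis s02 : 0 < s <= 2^-1.

(* The half-width of the cusp at abscissa s / 8. *)
Let w := (s / 8) `^ alpha^-1.

Lemma width_gt0 : 0 < w.
Proof. by case/andP: s02 => s0 _; rewrite powR_gt0// divr_gt0. Qed.

Lemma width_le : w <= s / 8.
Proof.
case/andP: s02 => s0 s2; apply: ge1r_powR; last exact: invalpha_ge1.
by apply/andP; split; lra.
Qed.

(** Points [z] of [s/4, 5s/4] x [-w/2, w/2], which contains the two rectangles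
    of the dipole, are at sup-norm distance at least [w / 2] from the
    complement of the cusp: as [w <= s / 8], a point [z'] nearer to
    [z] has abscissa larger than [s / 8], and [|z'.2| < w]. *)
Lemma cusp_central (z z' : R * R) :
  s / 4 <= z.1 <= 5 * s / 4 -> `|z.2| <= w / 2 ->
  `|z'.1 - z.1| < w / 2 -> `|z'.2 - z.2| < w / 2 -> cusp alpha z'.
Proof.
move=> /andP[z1 z2] zy; rewrite ltr_norml => /andP[d1 d2] d3.
case/andP: s02 => s0 s2; have wle := width_le; have w0 := width_gt0.
split; first by apply/andP; split; lra.
have : `|z'.2| < w.
  have -> : z'.2 = z.2 + (z'.2 - z.2) by lra.
  by apply: (le_lt_trans (ler_normD _ _)); lra.
move=> /lt_le_trans; apply; apply: ge0_ler_powR;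
  rewrite ?invalpha_ge0 ?nnegrE//; lra.
Qed.

(** The rectangle [s/4, s/2] x [-w/2, w/2], on which the dipole is 1. *)
Definition box_near : set (plane R) :=
  `[s / 4, s / 2]%classic `*` `[- (w / 2), w / 2]%classic.

(** Its translate [s, 5s/4] x [-w/2, w/2], on which the dipole is -1.  It lies
    in x >= s, where the cutoff function vanishes. *)
Definition box_far : set (plane R) :=
  `[s, 5 * s / 4]%classic `*` `[- (w / 2), w / 2]%classic.

Lemma measurable_box_near : measurable box_near.
Proof. by apply: measurableX; exact: measurable_itv. Qed.

Lemma measurable_box_far : measurable box_far.
Proof. by apply: measurableX; exact: measurable_itv. Qed.

Lemma leb2_box_near : leb2 box_near = (s * w / 4)%:E.
Proof.
case/andP: s02 => s0 _; have w0 := width_gt0.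
rewrite /box_near leb2_box; [|lra|lra].
by congr EFin; lra.
Qed.

Lemma leb2_box_far : leb2 box_far = (s * w / 4)%:E.
Proof.
case/andP: s02 => s0 _; have w0 := width_gt0.
rewrite /box_far leb2_box; [|lra|lra].
by congr EFin; lra.
Qed.

Lemma box_central z : (box_near `|` box_far) z ->
  s / 4 <= z.1 <= 5 * s / 4 /\ `|z.2| <= w / 2.
Proof.
case/andP: s02 => s0 _.
case=> -[/=]; rewrite !in_itv/= -ler_norml => /andP[z1 z2] z3; split => //.
  by apply/andP; split; lra.
by apply/andP; split; lra.
Qed.

Lemma box_sub_cusp : box_near `|` box_far `<=` cusp alpha.
Proof.
move=> z /box_central[z1 z2]; have w0 := width_gt0.
by apply: (cusp_central z1 z2); rewrite subrr normr0; lra.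
Qed.

(** The right-hand side of the divergence equation: it has mean value zero
    because the two rectangles have the same area. *)
Definition dipole : R * R -> R := \1_box_near \- \1_box_far.

Lemma measurable_dipole : measurable_fun setT (dipole : plane R -> R).
Proof.
apply: measurable_funB; apply: measurable_indic.
  exact: measurable_box_near.
exact: measurable_box_far.
Qed.

Lemma dipole_norm_le z : `|dipole z| <= \1_(box_near `|` box_far) z.
Proof.
rewrite /dipole/= !indicE in_setU.
case: (_ \in box_near); case: (_ \in box_far);
  by rewrite /= ?subrr ?subr0 ?sub0r ?normrN ?normr0 ?normr1.
Qed.

Variables (p beta : R).
Hypotheses (p1 : 1 < p) (beta0 : beta <= 0).

Let wf := weighted (cusp alpha) beta dipole.

Lemma weighted_dipole_le z :
  `|wf z| <= (w / 2) `^ beta * \1_(box_near `|` box_far) z.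
Proof.
rewrite /wf /weighted normrM [X in _ * X]ger0_norm ?powR_ge0//.
have := dipole_norm_le z; rewrite indicE.
case: (boolP (_ \in _)) => [zB|_]; last first.
  by rewrite mulr0 normr_le0 => /eqP ->; rewrite normr0 mul0r.
move=> f1; rewrite mulr1 -[leRHS]mul1r ler_pM ?powR_ge0//.
have [z1 z2] := box_central (set_mem zB).
apply: bdist_powR_le => //; first by rewrite divr_gt0// width_gt0.
by move=> z'; exact: cusp_central.
Qed.

Lemma measurable_weighted_dipole : measurable_fun setT (wf : plane R -> R).
Proof.
apply: measurable_funM; first exact: measurable_dipole.
apply: (@measurableT_comp _ _ _ _ _ _ (@powR R ^~ beta)).
  exact: measurable_powR.
exact: bdist_measurable.
Qed.

Lemma Lpnorm_weighted_dipole :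
  (Lpnorm (cusp alpha) p wf <= ((w / 2) `^ beta * (s * w / 2) `^ p^-1)%:E)%E.
Proof.
have p0 : 0 < p by exact: lt_trans p1.
have mB : measurable (box_near `|` box_far).
  by apply: measurableU; [exact: measurable_box_near|exact: measurable_box_far].
have mwf : measurable_fun setT ((wf \_ (cusp alpha)) : plane R -> R).
  apply: (measurable_restrictT wf measurable_cusp).1.
  by apply: measurable_funTS; exact: measurable_weighted_dipole.
have h z : `|(wf \_ (cusp alpha)) z| <=
    (w / 2) `^ beta * \1_(box_near `|` box_far) z.
  rewrite patchE; case: ifPn => _; first exact: weighted_dipole_le.
  by rewrite normr0 mulr_ge0 ?powR_ge0.
apply: le_trans (Lnorm_le_indic (@leb2 R) p0 (powR_ge0 _ _) mB mwf h) _.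
rewrite EFinM lee_wpmul2l ?lee_fin ?powR_ge0//.
have sw0 : 0 <= s * w / 2.
  by case/andP: s02 => s0 _; have w0 := width_gt0; rewrite !mulr_ge0// ltW.
rewrite -poweR_EFin; apply: gt0_ler_poweR; rewrite ?invr_ge0 ?(ltW p0)//.
- by rewrite in_itv; apply/andP; split; [exact: measure_ge0|exact: leey].
- by rewrite in_itv; apply/andP; split; [exact: sw0|exact: leey].
apply: le_trans (measureU2 _ measurable_box_near measurable_box_far) _.
rewrite [X in (X + _)%E]leb2_box_near [X in (_ + X)%E]leb2_box_far.
by rewrite -EFinD lee_fin; lra.
Qed.

Lemma inLp0_dipole : inLp0 (cusp alpha) p beta dipole.
Proof.
split.
- by apply: measurable_funTS; exact: measurable_dipole.
- rewrite /inLp inE; apply/andP; split.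
    rewrite inE/=; apply: (measurable_restrictT wf measurable_cusp).1.
    by apply: measurable_funTS; exact: measurable_weighted_dipole.
  rewrite inE/=; apply: le_lt_trans Lpnorm_weighted_dipole _; exact: ltry.
- have nc : box_near `<=` cusp alpha by move=> z zn; apply: box_sub_cusp; left.
  have fc : box_far `<=` cusp alpha by move=> z zn; apply: box_sub_cusp; right.
  have mn := measurable_box_near; have mf := measurable_box_far.
  have ii (B : set (plane R)) : measurable B ->
      (@leb2 R).-integrable (cusp alpha) (EFin \o \1_B).
    move=> mB; apply: (@integrable_bounded _ _ _ _ _ _ 1).
    - exact: measurable_cusp.
    - exact: leb2_cusp_lty.
    - exact: measurable_indic.
    - by move=> z _; rewrite indicE; case: (_ \in _); rewrite ?normr1 ?normr0.
  rewrite /dipole; under eq_integral do rewrite EFinB.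
  rewrite integralB; [|exact: measurable_cusp|exact: ii|exact: ii].
  rewrite !integral_indic//; try exact: measurable_cusp.
  by rewrite !setIidl// leb2_box_near leb2_box_far -EFinB subrr.
Qed.

End cusp_geometry.

(** * The cutoff function *)

(** The function eta(x) = max(s - x, 0)^2, of class C^1, and its derivative. *)
Definition cutoff (R : realType) (s x : R) : R := Num.max (s - x) 0 ^+ 2.
Definition cutoff' (R : realType) (s x : R) : R := - 2 * Num.max (s - x) 0.

Section cutoff.
Context {R : realType}.
Variable s : R.

Lemma cutoff_taylor (x h : R) :
  `|cutoff s (x + h) - cutoff s x - cutoff' s x * h| <= h ^+ 2.
Proof.
rewrite /cutoff /cutoff'.
have maxE (t : R) : Num.max t 0 = if 0 <= t then t else 0.
  by case: (leP 0 t).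
rewrite !maxE ler_norml.
case: (leP 0 (s - (x + h))) => h1; case: (leP 0 (s - x)) => h2;
  apply/andP; split; nra.
Qed.

Lemma is_derive_cutoff (x : R) : is_derive x (1 : R) (cutoff s) (cutoff' s x).
Proof.
have cv : (fun h : R =>
    h^-1 *: ((cutoff s \o shift x) (h *: (1 : R)) - cutoff s x))
    @ 0^' --> cutoff' s x.
  apply/cvgrPdist_le => e e0; near=> h.
  have h0 : h != 0 by near: h; exact: nbhs_dnbhs_neq.
  have he : `|h| <= e.
    by near: h; apply: dnbhs0_le.
  rewrite distrC /= /GRing.scale/= mulr1 [h + x]addrC.
  have -> : h^-1 * (cutoff s (x + h) - cutoff s x) - cutoff' s x =
      h^-1 * (cutoff s (x + h) - cutoff s x - cutoff' s x * h).
    by field.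
  rewrite normrM normfV ler_pdivrMl ?normr_gt0//.
  apply: (le_trans (cutoff_taylor x h)).
  by rewrite -real_normK ?num_real// expr2 ler_wpM2l.
by apply: DeriveDef; [apply/cvg_ex; exists (cutoff' s x)|exact: cvg_lim].
Unshelve. all: by end_near. Qed.

Lemma cutoff'_continuous : continuous (cutoff' s).
Proof.
move=> x; apply: cvgM; first exact: cvg_cst.
apply: (@continuous_comp _ _ _ (fun x : R => s - x) (fun t : R => Num.max t 0)).
  by apply: cvgB; [exact: cvg_cst|exact: cvg_id].
by apply: continuous_max => //; exact: cst_continuous.
Qed.

Lemma cutoff_ge0 x : 0 <= cutoff s x. Proof. exact: sqr_ge0. Qed.

Lemma cutoff_eq0 x : s <= x -> cutoff s x = 0.
Proof. by move=> sx; rewrite /cutoff max_r ?subr_le0// expr0n. Qed.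

Lemma cutoff'_eq0 x : s <= x -> cutoff' s x = 0.
Proof. by move=> sx; rewrite /cutoff' max_r ?subr_le0// mulr0. Qed.

Lemma cutoff_le x : 0 <= s -> 0 <= x -> cutoff s x <= s ^+ 2.
Proof.
move=> s0 x0; rewrite /cutoff ler_pXn2r// ?nnegrE ?le_max ?lexx ?orbT//.
by rewrite ge_max s0 andbT; lra.
Qed.

Lemma cutoff_ge x : 0 <= s -> x <= s / 2 -> (s / 2) ^+ 2 <= cutoff s x.
Proof.
move=> s0 xs; have h : s / 2 <= s - x by lra.
rewrite /cutoff ler_pXn2r ?nnegrE ?le_max ?h ?lexx ?orbT//; lra.
Qed.

Lemma cutoff'_norm_le x : 0 <= s -> 0 <= x -> `|cutoff' s x| <= 2 * s.
Proof.
move=> s0 x0; rewrite /cutoff'.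
have M0 : 0 <= Num.max (s - x) 0 by rewrite le_max lexx orbT.
have M1 : Num.max (s - x) 0 <= s by rewrite ge_max s0 andbT; lra.
by rewrite normrM normrN (ger0_norm M0) ger0_norm// ler_wpM2l.
Qed.

End cutoff.


Lemma sum_ord2 (V : nmodType) (F : 'I_2 -> V) :
  \sum_(i < 2) F i = F ord0 + F ord_max.
Proof.
rewrite big_ord_recl big_ord1; congr (_ + F _).
exact: val_inj.
Qed.

Section cusp_estimate.
Context {R : realType}.
Variables (alpha p s : R).
Hypotheses (alpha01 : 0 < alpha <= 1) (p1 : 1 < p) (s01 : 0 < s <= 2^-1).

Let Om := cusp alpha.
Let w := (s / 8) `^ alpha^-1.
Let W := s `^ alpha^-1.

Let mOm : measurable (Om : set (plane R)) := measurable_cusp alpha.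

Let measurable_comp_fst (a : R -> R) : continuous a ->
  measurable_fun Om ((fun z => a z.1) : plane R -> R).
Proof.
move=> ca; apply: measurable_funTS.
exact: (continuous_measurable_plane (@continuous_comp1 _ _ ca)).
Qed.

Let ceta : continuous (cutoff s) := is_derive_continuous (is_derive_cutoff s).

Lemma cusp_bounds z :
  Om z -> [/\ 0 <= z.1, `|z.2| <= 1 & z.1 < s -> `|z.2| <= W].
Proof.
move=> [/andP[z0 z1] zy]; split.
- exact: ltW.
- apply: (le_trans (ltW zy)).
  apply: (@le_trans _ _ (1 `^ alpha^-1)); last by rewrite powR1.
  by apply: ge0_ler_powR; rewrite ?invalpha_ge0 ?nnegrE// ltW.
- move=> zs; apply: (le_trans (ltW zy)).
  by apply: ge0_ler_powR; rewrite ?invalpha_ge0 ?nnegrE// ltW// (lt_trans z0).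
Qed.

Let s0 : 0 < s. Proof. by case/andP: s01. Qed.

Let mweight : measurable_fun Om ((fun z => z.2 * cutoff' s z.1) : plane R -> R).
Proof.
apply: measurable_funM;
  last exact: measurable_comp_fst (@cutoff'_continuous _ s).
by apply: measurable_funTS; exact: measurable_snd.
Qed.

(** The identity int eta div u = int y eta' d_2 u_1 on W^{1,p}_0. *)
Lemma cutoff_integral_identity (u : 'I_2 -> R * R -> R)
    (Du : 'I_2 -> 'I_2 -> R * R -> R) :
  (forall i, inW1p0 Om p (u i) (Du i)) ->
  (\int[@leb2 R]_(z in Om) (cutoff s z.1 * \sum_(i < 2) Du i i z)%:E =
   \int[@leb2 R]_(z in Om) (z.2 * cutoff' s z.1 * Du ord0 ord_max z)%:E)%E.
Proof.
move=> uW.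
have Omfin := leb2_cusp_lty alpha01.
have s2 : s <= 1 by case/andP: s01; lra.
have cb z : Om z -> `|cutoff s z.1| <= 2.
  move=> /cusp_bounds[z0 _ _]; rewrite ger0_norm ?cutoff_ge0//.
  by apply: (le_trans (cutoff_le (ltW s0) z0)); have := s0; nra.
have wb z : Om z -> `|z.2 * cutoff' s z.1| <= 2.
  move=> /cusp_bounds[z0 z2 _]; rewrite normrM.
  have := cutoff'_norm_le (ltW s0) z0; have := normr_ge0 (cutoff' s z.1).
  by have := normr_ge0 z.2; nra.
have Dui i j : (@leb2 R).-integrable Om (EFin \o Du i j).
  by apply: (inLp_integrable p1) => //; exact: ((uW i).1.2 j).1.
have bounded2 (a : R * R -> R) :
    (forall z, Om z -> `|a z| <= 2) -> [bounded a z | z in Om].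
  move=> ab; exists 2; split; first exact: num_real.
  by move=> M NM z Oz /=; rewrite (le_trans (ab z Oz)) ?ltW.
have ic i j : (@leb2 R).-integrable Om (fun z => (cutoff s z.1 * Du i j z)%:E).
  exact: (integrableMr mOm (measurable_comp_fst ceta) (bounded2 _ cb)
    (Dui i j)).
have iw i j : (@leb2 R).-integrable Om
    (fun z => (z.2 * cutoff' s z.1 * Du i j z)%:E).
  exact: (integrableMr mOm mweight (bounded2 _ wb) (Dui i j)).
(* The gradient of u_1 is tested against (eta, - y eta'), that of u_2 against
   (0, eta). *)
have e0 : (\int[@leb2 R]_(z in Om) (cutoff s z.1 * Du ord0 ord0 z)%:E =
   \int[@leb2 R]_(z in Om) (z.2 * cutoff' s z.1 * Du ord0 ord_max z)%:E)%E.
  pose g0 (i : 'I_2) (z : R * R) : R :=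
    if i == ord0 then cutoff s z.1 else - (z.2 * cutoff' s z.1).
  have mg0 i : measurable_fun Om (g0 i : plane R -> R).
    rewrite /g0; case: (i == ord0); first exact: measurable_comp_fst.
    exact: measurableT_comp.
  have gb0 i z : Om z -> `|g0 i z| <= 2.
    by rewrite /g0; case: (i == ord0) => Oz; rewrite ?normrN;
      [exact: cb|exact: wb].
  have t0 phi : test_function Om phi ->
     (\int[@leb2 R]_(z in Om) (\sum_(i < 2) g0 i z * partial i phi z)%:E = 0)%E.
    move=> tphi; under eq_integral do rewrite sum_ord2 /g0/=.
    exact: (integral_weight_partial1 (is_derive_cutoff s)
      (@cutoff'_continuous _ s)).
  have := inW1p0_integral_eq0 p1 mOm Omfin mg0 gb0 t0 (uW ord0).
  under eq_integral do rewrite sum_ord2 /g0/= mulNr EFinB.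
  rewrite integralB// => /eqP; rewrite sube_eq ?add0e; first by move/eqP.
    exact: integrable_fin_num.
  by rewrite fin_num_adde_defr// integrable_fin_num.
have e1 : (\int[@leb2 R]_(z in Om)
    (cutoff s z.1 * Du ord_max ord_max z)%:E = 0)%E.
  pose g1 (i : 'I_2) (z : R * R) : R := if i == ord0 then 0 else cutoff s z.1.
  have mg1 i : measurable_fun Om (g1 i : plane R -> R).
    rewrite /g1; case: (i == ord0); first exact: measurable_cst.
    exact: measurable_comp_fst.
  have gb1 i z : Om z -> `|g1 i z| <= 2.
    by rewrite /g1; case: (i == ord0) => Oz; [rewrite normr0|exact: cb].
  have t1 phi : test_function Om phi ->
     (\int[@leb2 R]_(z in Om) (\sum_(i < 2) g1 i z * partial i phi z)%:E = 0)%E.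
    move=> tphi; under eq_integral do rewrite sum_ord2 /g1/= mul0r add0r.
    exact: (integral_weight_partial2 (is_derive_cutoff s)).
  have := inW1p0_integral_eq0 p1 mOm Omfin mg1 gb1 t1 (uW ord_max).
  by under eq_integral do rewrite sum_ord2 /g1/= mul0r add0r.
under eq_integral do rewrite sum_ord2 mulrDr EFinD.
by rewrite integralD// e0 e1 adde0.
Qed.

(** The cutoff is at least (s/2)^2 on the first rectangle and 0 on the second
    one. *)
Lemma cutoff_dipole_integral :
  ((s ^+ 2 / 4 * (s * w / 4))%:E <=
   \int[@leb2 R]_(z in Om) (cutoff s z.1 * dipole alpha s z)%:E)%E.
Proof.
have mn := measurable_box_near alpha s.
have nc : box_near alpha s `<=` Om.
  by move=> z zn; apply: (box_sub_cusp alpha01 s01); left.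
have Omfin := leb2_cusp_lty alpha01.
have -> : ((s ^+ 2 / 4 * (s * w / 4))%:E =
    \int[@leb2 R]_(z in Om) ((s / 2) ^+ 2 * \1_(box_near alpha s) z)%:E)%E.
  under eq_integral do rewrite EFinM.
  rewrite ge0_integralZl//=; last 2 first.
    by apply/measurable_EFinP; exact: measurable_indic.
    by rewrite lee_fin sqr_ge0.
  rewrite integral_indic// setIidl// [X in (_ * X)%E](leb2_box_near alpha s01).
  by rewrite -EFinM; congr EFin; rewrite -/w; field.
have fE z : Om z -> (s / 2) ^+ 2 * \1_(box_near alpha s) z <=
    cutoff s z.1 * dipole alpha s z <= s ^+ 2.
  move=> Oz; have [z0 _ _] := cusp_bounds Oz.
  have c0 := cutoff_ge0 s z.1; have cs := cutoff_le (ltW s0) z0.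
  rewrite /dipole/= !indicE.
  have -> : cutoff s z.1 *
      ((z \in box_near alpha s)%:R - (z \in box_far alpha s)%:R) =
      cutoff s z.1 * (z \in box_near alpha s)%:R :> R.
    case: (boolP (z \in box_far alpha s)) => [/set_mem[/=]|_];
      last by rewrite subr0.
    by rewrite in_itv/= => /andP[sz _] _; rewrite cutoff_eq0// !mul0r.
  case: (boolP (z \in box_near alpha s)) => [/set_mem[/=]|_]; last first.
    by rewrite !mulr0 lexx sqr_ge0.
  rewrite in_itv/= => /andP[_ zs] _; rewrite !mulr1 cs andbT.
  exact: (cutoff_ge (ltW s0) zs).
apply: le_integral.
- exact: mOm.
- apply: (@integrable_bounded _ _ _ _ _ _ ((s / 2) ^+ 2)) => //.
    apply: measurable_funM; first exact: measurable_cst.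
    exact: measurable_indic.
  move=> z _; rewrite indicE.
  case: (_ \in _); rewrite ?mulr1 ?mulr0 ?normr0 ?sqr_ge0//.
  by rewrite ger0_norm ?sqr_ge0.
- apply: (@integrable_bounded _ _ _ _ _ _ (s ^+ 2)) => //.
    apply: measurable_funM; first exact: measurable_comp_fst.
    by apply: measurable_funTS; exact: measurable_dipole.
  move=> z /fE/andP[h1 h2]; rewrite ger0_norm//; apply: le_trans h1.
  by rewrite mulr_ge0 ?sqr_ge0.
- by move=> z /set_mem /fE/andP[h1 _]; rewrite lee_fin.
Qed.

(** As [cutoff'] vanishes for x >= s, only the tip of the cusp contributes. *)
Lemma weighted_partial_le (v : R * R -> R) : inLp Om p v ->
  (`| \int[@leb2 R]_(z in Om) (z.2 * cutoff' s z.1 * v z)%:E | <=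
   (2 * s * W * (2 * s * W) `^ (1 - p^-1))%:E * Lpnorm Om p v)%E.
Proof.
move=> vp.
have W0 : 0 <= W := powR_ge0 _ _.
pose S : set (plane R) := Om `&` [set z | z.1 < s].
have mS : measurable S := measurable_cusp_slab alpha s.
have SOm : S `<=` Om by move=> z [].
have mv := inLp_measurable mOm vp.
have -> : (\int[@leb2 R]_(z in Om) (z.2 * cutoff' s z.1 * v z)%:E =
    \int[@leb2 R]_(z in S) (z.2 * cutoff' s z.1 * v z)%:E)%E.
  rewrite [LHS]integral_mkcond [RHS]integral_mkcond; apply: eq_integral => z _.
  rewrite !patchE; case: (boolP (z \in Om)) => zOm; last first.
    case: (boolP (z \in S)) => // /set_mem[/mem_set zOm' _].
    by rewrite zOm' in zOm.
  case: (boolP (z \in S)) => // /negP zS.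
  rewrite cutoff'_eq0 ?mulr0 ?mul0r// leNgt; apply/negP => zs.
  by apply: zS; apply/mem_set; split => //; exact: set_mem.
have wb z : S z -> `|z.2 * cutoff' s z.1| <= 2 * s * W.
  move=> [/cusp_bounds[z0 _ zW] zs].
  rewrite normrM mulrC ler_pM//; [exact: cutoff'_norm_le (ltW s0) z0|exact: zW].
apply: (le_trans (abse_integral_mul_bounded (@leb2 R) mS
  (measurable_funS mOm SOm mweight) (measurable_funS mOm SOm mv) _ wb)).
  by rewrite !mulr_ge0// ltW.
rewrite [in leRHS]EFinM -muleA lee_wpmul2l ?lee_fin ?mulr_ge0 ?(ltW s0)//.
apply: (le_trans (integral_le_Lpnorm p1 mOm mS SOm mv)).
rewrite lee_wpmul2r ?Lnorm_ge0// -poweR_EFin.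
have q0 : 0 <= 1 - p^-1 by rewrite subr_ge0 invf_le1 ?ltW// (lt_trans _ p1).
apply: gt0_ler_poweR => //.
- by rewrite in_itv; apply/andP; split; [exact: measure_ge0|exact: leey].
- have sW0 : 0 <= 2 * s * W by rewrite !mulr_ge0// ltW.
  by rewrite in_itv; apply/andP; split; [exact: sW0|exact: leey].
- exact: leb2_cusp_slab.
Qed.

End cusp_estimate.

(** * The inequality at scale s and its failure as s tends to 0 *)

(** The lower bound [cutoff_dipole_integral] and the upper bound
    [weighted_partial_le] applied to a solution of the divergence equation
    with the dipole at scale [s] as right-hand side.  The constant of the right
    inverse may be negative, hence the absolute value. *)
Lemma right_inverse_scale_inequality (R : realType) (alpha p beta : R) :
  0 < alpha <= 1 -> 1 < p -> beta <= 0 ->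
  div_has_continuous_right_inverse (cusp alpha) p beta ->
  exists2 C : R, 0 <= C & forall s : R, 0 < s <= 2^-1 ->
    let w := (s / 8) `^ alpha^-1 in
    let L := 2 * s * s `^ alpha^-1 in
    s ^+ 2 / 4 * (s * w / 4) <=
    L * L `^ (1 - p^-1) * (C * ((w / 2) `^ beta * (s * w / 2) `^ p^-1)).
Proof.
move=> alpha01 p1 beta0 [C HC]; exists `|C|; [exact: normr_ge0|move=> s s01 /=].
set w := (s / 8) `^ alpha^-1; set L := 2 * s * s `^ alpha^-1.
have [u [Du [uW divu normu]]] := HC _ (inLp0_dipole alpha01 s01 p1 beta0).
have L0 : 0 <= L.
  by case/andP: s01 => s0 _; rewrite !mulr_ge0 ?powR_ge0// ltW.
have mOm := measurable_cusp alpha.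
have Dup i j : inLp (cusp alpha) p (Du i j) by exact: ((uW i).1.2 j).1.
have mDu i j := inLp_measurable mOm (Dup i j).
have mcut : measurable_fun (cusp alpha)
    ((fun z => cutoff s z.1) : plane R -> R).
  apply: measurable_funTS; apply: continuous_measurable_plane.
  exact: (continuous_comp1 (is_derive_continuous (is_derive_cutoff s))).
have div_eq : (\int[@leb2 R]_(z in cusp alpha)
      (cutoff s z.1 * dipole alpha s z)%:E =
    \int[@leb2 R]_(z in cusp alpha)
      (z.2 * cutoff' s z.1 * Du ord0 ord_max z)%:E)%E.
  rewrite -(cutoff_integral_identity alpha01 p1 s01 uW).
  apply: ae_eq_integral => //.
  - apply/measurable_EFinP; apply: measurable_funM => //.
    by apply: measurable_funTS; exact: measurable_dipole.
  - apply/measurable_EFinP; apply: measurable_funM => //.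
    under eq_fun do rewrite sum_ord2.
    by apply: measurable_funD; exact: mDu.
  - case: divu => N [mN N0 sub]; exists N; split => // z nz; apply: sub => h.
    by apply: nz => Oz; rewrite h.
have Dn : (Lpnorm (cusp alpha) p (Du ord0 ord_max) <=
    (`|C| * ((w / 2) `^ beta * (s * w / 2) `^ p^-1))%:E)%E.
  apply: le_trans (Lpnorm_partial_le_W1pnorm _ p1 (u ord0) _ ord_max) _.
  apply: le_trans (W1pnorm_le_W1pnorm_vec _ p1 u Du ord0) _.
  apply: (le_trans normu); apply: (@le_trans _ _ (`|C|%:E *
    Lpnorm (cusp alpha) p (weighted (cusp alpha) beta (dipole alpha s)))%E).
    by rewrite lee_wpmul2r ?Lnorm_ge0// lee_fin ler_norm.
  rewrite [leRHS]EFinM lee_wpmul2l ?lee_fin//.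
  exact: Lpnorm_weighted_dipole.
rewrite -lee_fin.
apply: (le_trans (cutoff_dipole_integral alpha01 s01)).
rewrite div_eq; apply: (le_trans (lee_abs _)).
apply: (le_trans (weighted_partial_le alpha01 p1 s01 (Dup _ _))).
by rewrite [leRHS]EFinM lee_wpmul2l// lee_fin mulr_ge0 ?powR_ge0.
Qed.

Lemma powR_lt1_near0 (R : realType) (K e : R) : 0 <= K -> 0 < e ->
  exists2 t : R, 0 < t <= 16^-1 & K * t `^ e < 1.
Proof.
move=> K0 e0.
pose t := Num.min 16^-1 ((K + 1)^-1 `^ e^-1).
have K1 : 0 < (K + 1)^-1 by rewrite invr_gt0 ltr_wpDl.
have t0 : 0 < t by rewrite lt_min powR_gt0// andbT invr_gt0.
exists t; first by rewrite t0 ge_min lexx.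
have : t `^ e <= (K + 1)^-1.
  have -> : (K + 1)^-1 = ((K + 1)^-1 `^ e^-1) `^ e.
    by rewrite -powRrM mulVf ?gt_eqF// powRr1// ltW.
  apply: ge0_ler_powR; [exact: ltW|exact: ltW|exact: powR_ge0|].
  by rewrite ge_min lexx orbT.
move=> h; apply: (le_lt_trans (ler_wpM2l K0 h)).
by rewrite ltr_pdivrMr ?mul1r; lra.
Qed.

(** All lengths are powers of [s] up to constants, and [s * w / 2 <= L]; so
    [L * L `^ (1 - p^-1) * (s * w / 2) `^ p^-1 <= L ^+ 2], and dividing by
    [s ^+ 2 * w / 16] leaves an inequality without [p]. *)
Lemma scale_inequality_cancel (R : realType) (g p beta C s : R) :
  1 <= g -> 1 < p -> 0 <= C -> 0 < s <= 2^-1 ->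
  let w := (s / 8) `^ g in
  let L := 2 * s * s `^ g in
  s ^+ 2 / 4 * (s * w / 4) <=
    L * L `^ (1 - p^-1) * (C * ((w / 2) `^ beta * (s * w / 2) `^ p^-1)) ->
  s <= 64 * C * (8 `^ g) ^+ 2 * 2^-1 `^ beta * (s / 8) `^ (g * (1 + beta)).
Proof.
move=> g1 p1 C0 /andP[s0 s2] w L; have p0 : 0 < p by exact: lt_trans p1.
have t0 : 0 < s / 8 by rewrite divr_gt0.
have w0 : 0 < w by rewrite powR_gt0.
set G := 8 `^ g.
have G1 : 1 <= G.
  apply: (@le_trans _ _ (8 `^ 0)); first by rewrite powRr0.
  by apply: ler_powR; [rewrite ler1n|exact: le_trans g1].
have sG : s `^ g = G * w.
  rewrite /G /w -powRM ?(ltW t0)//; congr (_ `^ _); lra.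
have LE : L = 2 * s * (G * w) by rewrite /L sG.
have L0 : 0 < L by rewrite LE !mulr_gt0// (lt_le_trans _ G1).
have swL : s * w / 2 <= L.
  have sw0 : 0 < s * w by rewrite mulr_gt0.
  have -> : L = 2 * G * (s * w) by rewrite LE; ring.
  by nra.
have pow : L `^ (1 - p^-1) * (s * w / 2) `^ p^-1 <= L.
  apply: (@le_trans _ _ (L `^ (1 - p^-1) * L `^ p^-1)).
    rewrite ler_wpM2l ?powR_ge0//; apply: ge0_ler_powR => //.
    - by rewrite invr_ge0 ltW.
    - by rewrite nnegrE !mulr_ge0 ?invr_ge0// ltW.
    - by rewrite nnegrE ltW.
  by rewrite -powRD ?subrK ?powRr1 ?(ltW L0)// oner_eq0.
have wb : (w / 2) `^ beta = 2^-1 `^ beta * w `^ beta.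
  by rewrite mulrC powRM// ltW.
have ww : w * w `^ beta = (s / 8) `^ (g * (1 + beta)).
  rewrite powRrM -/w powRD ?powRr1 ?(ltW w0)//.
  by apply/implyP => _; rewrite gt_eqF.
move=> H.
have H2 : s ^+ 2 / 4 * (s * w / 4) <= C * (L * L * (w / 2) `^ beta).
  apply: (le_trans H).
  have -> : L * L `^ (1 - p^-1) *
      (C * ((w / 2) `^ beta * (s * w / 2) `^ p^-1)) =
    C * (L * (L `^ (1 - p^-1) * (s * w / 2) `^ p^-1) * (w / 2) `^ beta) by ring.
  rewrite ler_wpM2l// ler_wpM2r ?powR_ge0// ler_wpM2l//; exact: ltW.
have sw0 : 0 < s ^+ 2 * w / 16 by rewrite divr_gt0 ?mulr_gt0 ?exprn_gt0.
rewrite -(ler_pM2l sw0) -ww.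
have -> : s ^+ 2 * w / 16 * s = s ^+ 2 / 4 * (s * w / 4) by field.
apply: (le_trans H2); rewrite wb LE -/G le_eqVlt; apply/orP; left; apply/eqP.
by field.
Qed.

Theorem theorem4p2 (R : realType) (alpha p beta : R) :
  0 < alpha <= 1 -> 1 < p -> beta <= 0 ->
  div_has_continuous_right_inverse (cusp alpha) p beta ->
  beta <= alpha - 1.
Proof.
move=> alpha01 p1 beta0 divinv.
have [C C0 scale] := right_inverse_scale_inequality alpha01 p1 beta0 divinv.
rewrite leNgt; apply/negP => ab.
have a0 : 0 < alpha by case/andP: alpha01.
have g1 := invalpha_ge1 alpha01.
pose K := 64 * C * (8 `^ alpha^-1) ^+ 2 * 2^-1 `^ beta.
pose e := alpha^-1 * (1 + beta) - 1.
have e0 : 0 < e by rewrite subr_gt0 mulrC ltr_pdivlMr// mul1r; lra.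
have K0 : 0 <= K by rewrite !mulr_ge0 ?powR_ge0 ?sqr_ge0.
have [t /andP[t0 t16] Kt] := powR_lt1_near0 K0 e0.
have s01 : 0 < 8 * t <= 2^-1 by apply/andP; split; lra.
have := scale_inequality_cancel g1 p1 C0 s01 (scale _ s01).
rewrite -/K.
have -> : 8 * t / 8 = t by lra.
have -> : alpha^-1 * (1 + beta) = 1 + e by rewrite /e; lra.
rewrite powRD ?powRr1 ?(ltW t0)//; last by apply/implyP => _; rewrite gt_eqF.
have : t * (K * t `^ e) < t by rewrite gtr_pMr.
rewrite mulrCA; lra.
Qed.
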